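(* Let $m$ be a positive integer and $\lambda$ a nonzero real number. For integers $n\ge1$ and $0\le k\le n$, $$V_{m,\lambda}(n,k)=(m-nm-1)V_{m,\lambda}(n-1,k)+V_{m,\lambda}(n-1,k-1)+k\lambda V_{m,\lambda}(n-1,k),$$ with the convention $V_{m,\lambda}(n-1,-1)=0$ and $V_{m,\lambda}(n-1,n)=0$.
   Context: For a nonzero real $\lambda$: $(x)_{0,\lambda}=1$, $(x)_{n,\lambda}=x(x-\lambda)\cdots(x-(n-1)\lambda)$ for $n\ge1$; $(x)_n=(x)_{n,1}$. The degenerate Whitney numbers of the first kind $V_{m,\lambda}(n,k)$ are defined by $m^{n}(x)_{n}=\sum_{k=0}^{n}V_{m,\lambda}(n,k)(mx+1)_{k,\lambda}$ for $n\ge0$, and $V_{m,\lambda}(n,k)=0$ if $k<0$ or $k>n$. *)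

(* Defs.v *)
From HB Require Import structures.
From mathcomp Require Import all_boot all_order all_algebra.
From mathcomp Require Import boolp classical_sets reals.

Set Implicit Arguments.
Unset Strict Implicit.
Unset Printing Implicit Defensive.

Import Order.TTheory GRing.Theory Num.Theory.
Local Open Scope ring_scope.

(* (x)_{n,lambda} = x (x - lambda) ... (x - (n-1) lambda); lambda = 1 gives the
   ordinary falling factorial (x)_n. *)
Definition degenerate_ffact (R : nzRingType) (lambda x : R) (n : nat) : R :=
  \prod_(i < n) (x - i%:R * lambda).

(* The lower index ranges over all integers, so that terms such as V(n-1,-1)
   and V(n-1,n) are literally values of V. *)
Definition is_degenerate_whitney1 (R : realType) (m : nat) (lambda : R)
    (V : nat -> int -> R) : Prop :=
  (forall (n : nat) (x : R),
     m%:R ^+ n * degenerate_ffact 1 x n =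
     \sum_(k < n.+1) V n k%:Z * degenerate_ffact lambda (m%:R * x + 1) k) /\
  (forall (n : nat) (k : int), (k < 0) || (n%:Z < k) -> V n k = 0).

(* V_{m,lambda}(n,k). The default value of xget plays no role when 0 < m: by
   degenerate_whitney1P and degenerate_whitney1_unique below, there is exactly
   one family satisfying the predicate. *)
Definition degenerate_whitney1 (R : realType) (m : nat) (lambda : R)
    : nat -> int -> R :=
  xget (fun _ _ => 0) [set V | is_degenerate_whitney1 m lambda V].

Section WellDefined.

Variable R : realType.

Lemma triangular_exists (q : nat -> {poly R}) (n : nat) (p : {poly R}) :
  (forall k, size (q k) = k.+1) -> (size p <= n)%N ->
  exists c : nat -> R, p = \sum_(k < n) c k *: q k.
Proof.
move=> sq; elim: n p => [|n IHn] p.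
  rewrite leqn0 size_poly_eq0 => /eqP->.
  by exists (fun=> 0); rewrite big_ord0.
move=> sp; pose a := p`_n / lead_coef (q n).
have qn0 : lead_coef (q n) != 0 by rewrite lead_coef_eq0 -size_poly_eq0 sq.
have [|c Ec] := IHn (p - a *: q n).
  apply/leq_sizeP => j; rewrite leq_eqVlt => /predU1P[<-|ltnj].
    have -> : (p - a *: q n)`_n = p`_n - a * lead_coef (q n).
      by rewrite coefB coefZ lead_coefE sq.
    by rewrite divfK // subrr.
  rewrite coefB coefZ (leq_sizeP _ _ sp) // nth_default ?sq //.
  by rewrite mulr0 subrr.
exists (fun k => if k == n then a else c k).
rewrite big_ord_recr /= eqxx -[LHS](subrK (a *: q n)) Ec; congr (_ + _).
by apply: eq_bigr => i _; rewrite ltn_eqF.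
Qed.

Lemma triangular_free (q : nat -> {poly R}) (n : nat) (c : nat -> R) :
  (forall k, size (q k) = k.+1) -> \sum_(k < n) c k *: q k = 0 ->
  forall k, (k < n)%N -> c k = 0.
Proof.
move=> sq; elim: n => [//|n IHn]; rewrite big_ord_recr /= => E0.
have cn0 : c n = 0.
  have /(congr1 (fun p : {poly R} => p`_n)) := E0.
  rewrite coefD coef0 coefZ coef_sum big1 => [|i _]; last first.
    by rewrite coefZ nth_default ?mulr0 // sq.
  rewrite add0r => /eqP; rewrite mulf_eq0 => /orP[/eqP //|].
  have -> : (q n)`_n = lead_coef (q n) by rewrite lead_coefE sq.
  by rewrite lead_coef_eq0 -size_poly_eq0 sq.
move=> k; rewrite ltnS leq_eqVlt => /predU1P[-> //|]; apply: IHn.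
by move: E0; rewrite cn0 scale0r addr0.
Qed.

Lemma poly_fun0 (p : {poly R}) : (forall x, p.[x] = 0) -> p = 0.
Proof.
move=> p0; apply/eqP/negPn/negP => pn0.
pose s := [seq i%:R : R | i <- iota 0 (size p)].
have : (size s < size p)%N.
  apply: max_poly_roots => //; first by apply/allP => x _; apply/rootP.
  by rewrite map_inj_uniq ?iota_uniq // => i j /eqP; rewrite eqr_nat => /eqP.
by rewrite size_map size_iota ltnn.
Qed.

Lemma horner_degenerate_ffact (lambda : R) (p : {poly R}) (n : nat) (x : R) :
  (degenerate_ffact lambda%:P p n).[x] = degenerate_ffact lambda p.[x] n.
Proof.
rewrite /degenerate_ffact horner_prod; apply: eq_bigr => i _.
by rewrite hornerD hornerN hornerM hornerC -polyC_natr hornerC.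
Qed.

Lemma size_degenerate_ffact (lambda a b : R) (n : nat) :
  a != 0 -> size (degenerate_ffact lambda%:P (a *: 'X + b%:P) n) = n.+1.
Proof.
move=> a0; elim: n => [|n IHn]; rewrite /degenerate_ffact.
  by rewrite big_ord0 size_poly1.
rewrite big_ord_recr /= -/(degenerate_ffact _ _ _).
have -> : a *: 'X + b%:P - n%:R * lambda%:P = a *: 'X + (b - n%:R * lambda)%:P.
  by rewrite polyCB polyCM polyC_natr addrA.
have s2 : size (a *: 'X + (b - n%:R * lambda)%:P) = 2%N.
  rewrite size_polyDl size_scale // size_polyX //.
  exact: leq_ltn_trans (size_polyC_leq1 _) _.
by rewrite size_mul ?IHn ?s2 ?addn2 // -size_poly_eq0 ?IHn ?s2.
Qed.

Variables (m : nat) (lambda : R).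
Hypothesis m_gt0 : (0 < m)%N.

Let q (k : nat) : {poly R} :=
  degenerate_ffact lambda%:P (m%:R *: 'X + 1%:P) k.

Let sq k : size (q k) = k.+1.
Proof. by apply: size_degenerate_ffact; rewrite pnatr_eq0 -lt0n. Qed.

Let qE k x : (q k).[x] = degenerate_ffact lambda (m%:R * x + 1) k.
Proof. by rewrite horner_degenerate_ffact hornerD hornerZ hornerX hornerC. Qed.

Lemma degenerate_whitney1_exists :
  exists V, is_degenerate_whitney1 m lambda V.
Proof.
pose p n : {poly R} := m%:R ^+ n *: degenerate_ffact 1%:P (1 *: 'X + 0%:P) n.
have sp n : (size (p n) <= n.+1)%N.
  by rewrite (leq_trans (size_scale_leq _ _)) ?size_degenerate_ffact ?oner_neq0.
have /choice[c cE] n := triangular_exists sq (sp n).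
exists (fun n k => if k is Posz j then (if (j <= n)%N then c n j else 0) else 0).
split=> [n x|n [j|j] //=]; last by rewrite ltz_nat ltnNge => /negPf ->.
have := congr1 (fun r => r.[x]) (cE n).
rewrite /p hornerZ horner_degenerate_ffact scale1r hornerD hornerX hornerC addr0.
move=> ->; rewrite horner_sum; apply: eq_bigr => k _.
by rewrite hornerZ qE -ltnS ltn_ord.
Qed.

Lemma degenerate_whitney1_unique (V W : nat -> int -> R) :
  is_degenerate_whitney1 m lambda V -> is_degenerate_whitney1 m lambda W ->
  forall n k, V n k = W n k.
Proof.
move=> [V1 V0] [W1 W0] n k.
have [kout|] := boolP ((k < 0) || (n%:Z < k)); first by rewrite V0 ?W0.
rewrite negb_or -!leNgt; case: k => [k|//] /= lekn.
apply/eqP; rewrite -subr_eq0; apply/eqP.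
apply: (@triangular_free q n.+1 (fun k => V n k%:Z - W n k%:Z)) => //.
apply: poly_fun0 => x; rewrite horner_sum.
under eq_bigr do rewrite hornerZ qE mulrBl.
by rewrite sumrB -V1 -W1 subrr.
Qed.

Lemma degenerate_whitney1P :
  is_degenerate_whitney1 m lambda (degenerate_whitney1 m lambda).
Proof. exact: xgetPex degenerate_whitney1_exists. Qed.

End WellDefined.

(* Main.v *)
(** Since [m x - n m = (m x + 1 - k lambda) + (k lambda - 1 - n m)], multiplying
    the expansion of [m^n (x)_n] by [m (x - n)] expands [m^(n+1) (x)_(n+1)] in
    the degenerate factorials of [m x + 1], with the coefficients given by the
    recurrence; they are the Whitney numbers by uniqueness of the expansion. *)
Require Import Defs.
From HB Require Import structures.
From mathcomp Require Import all_boot all_order all_algebra.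
From mathcomp Require Import boolp classical_sets reals.
From mathcomp Require Import ring zify.
Import Order.TTheory GRing.Theory Num.Theory.
Local Open Scope ring_scope.

Lemma degenerate_ffactS (R : nzRingType) (lambda x : R) (n : nat) :
  degenerate_ffact lambda x n.+1 =
  degenerate_ffact lambda x n * (x - n%:R * lambda).
Proof. by rewrite /degenerate_ffact big_ord_recr. Qed.

(** Packaged as a whole family so that uniqueness can compare it with [V]; the recurrence says
    nothing about row 0, which is copied. *)
Definition whitney1_step (R : realType) (m : nat) (lambda : R)
    (V : nat -> int -> R) (n : nat) (k : int) : R :=
  if n is n'.+1 then
    (m%:R - n%:R * m%:R - 1) * V n' k + V n' (k - 1) + k%:~R * lambda * V n' k
  else V 0%N k.

Lemma is_degenerate_whitney1_step (R : realType) (m : nat) (lambda : R)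
    (V : nat -> int -> R) :
  is_degenerate_whitney1 m lambda V ->
  is_degenerate_whitney1 m lambda (whitney1_step R m lambda V).
Proof.
move=> [V1 V0]; split=> [[|n] x|[|n] k kout]; [exact: V1| |exact: V0|]; last first.
  (* If [k] lies outside row [n.+1], both [k] and [k - 1] lie outside row [n]. *)
  by rewrite /= !V0 ?mulr0 ?addr0 //; lia.
set f := degenerate_ffact lambda (m%:R * x + 1).
have -> : \sum_(k < n.+2) whitney1_step R m lambda V n.+1 k * f k =
    \sum_(k < n.+2) (m%:R - n.+1%:R * m%:R - 1 + k%:R * lambda) * V n k * f k +
    \sum_(k < n.+2) V n (k%:Z - 1) * f k.
  by rewrite -big_split; apply: eq_bigr => k _ /=; rewrite -pmulrn; ring.
(* The top term of the first sum and the bottom term of the shifted one vanish, leaving two sums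
   over [k < n.+1] to merge. *)
rewrite big_ord_recr [X in _ + X]big_ord_recl /=.
rewrite (V0 n n.+1); last by lia.
rewrite (V0 n (0%:Z - 1)); last by lia.
rewrite mulr0 !mul0r addr0 add0r -big_split /=.
have -> : m%:R ^+ n.+1 * degenerate_ffact 1 x n.+1 =
    m%:R ^+ n * degenerate_ffact 1 x n * (m%:R * x - n%:R * m%:R).
  by rewrite degenerate_ffactS exprS; ring.
rewrite V1 big_distrl /=; apply: eq_bigr => k _.
rewrite (_ : (bump 0 k)%:Z - 1 = k%:Z); last by rewrite /bump; lia.
(* As [f k.+1 = f k * (m x + 1 - k lambda)], the [k lambda] terms cancel and the factor [m x - n m]
   remains. *)
by rewrite /f degenerate_ffactS -natr1; ring.
Qed.

Theorem theorem7 (R : realType) (m : nat) (lambda : R)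
    (m_gt0 : (0 < m)%N) (lambda_neq0 : lambda != 0)
    (n k : nat) (n_ge1 : (1 <= n)%N) (k_le_n : (k <= n)%N) :
  let V := degenerate_whitney1 m lambda in
  V n k%:Z = (m%:R - n%:R * m%:R - 1) * V n.-1 k%:Z
             + V n.-1 (k%:Z - 1) + k%:R * lambda * V n.-1 k%:Z.
Proof.
case: n n_ge1 k_le_n => // n _ _ V.
have VP : is_degenerate_whitney1 m lambda V by exact: degenerate_whitney1P.
exact: (degenerate_whitney1_unique m_gt0 VP (is_degenerate_whitney1_step _ _ _ _ VP)).
Qed.
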